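(* Consider the iterates of SAS-ADMM (defined in the context) and fix an outer index $k\ge 0$ with $\eta_k\in(0,1/\nu)$. Then for every $w=(x;y;\lambda)\in\Omega$, $$F(w)-F(\tilde w^k)+\langle w-\tilde w^k,\mathcal J(w)\rangle\;\ge\;(w-\tilde w^k)^\top Q_k\,(w^k-\tilde w^k)+\zeta^k(x),$$ where $$Q_k=\begin{bmatrix}\mathcal D_k&0&0\\0&L+\beta B^\top B&-\tau B^\top\\0&-B&\frac1\beta I\end{bmatrix}.$$ (The inequality holds for every realization of the random quantities.)
   Context: Setting. $\mathcal X\subset\mathbb R^{n_1}$, $\mathcal Y\subset\mathbb R^{n_2}$ are nonempty closed convex sets; $A\in\mathbb R^{n\times n_1}$, $B\in\mathbb R^{n\times n_2}$, $b\in\mathbb R^n$; $g:\mathcal Y\to\mathbb R\cup\{+\infty\}$ is proper convex; $f=\frac1N\sum_{j=1}^N f_j$, each $f_j$ real-valued, convex and continuously differentiable on an open set containing $\mathcal X$. The problem is $\min\{f(x)+g(y): x\in\mathcal X,\ y\in\mathcal Y,\ Ax+By=b\}$. A fixed symmetric positive definite $H\in\mathbb R^{n_1\times n_1}$ and a constant $\nu>0$ satisfy $\|\nabla f_j(x_1)-\nabla f_j(x_2)\|_{H^{-1}}\le \nu\|x_1-x_2\|_H$ for all $x_1,x_2\in\mathcal X$ and all $j$. For a symmetric matrix $G$, $\|v\|_G^2:=v^\top G v$ (also when $G$ is indefinite); $G_1\succeq G_2$ means $G_1-G_2$ is positive semidefinite. $\mathcal L_\beta(x,y,\lambda)=f(x)+g(y)-\lambda^\top(Ax+By-b)+\frac\beta2\|Ax+By-b\|^2$.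 $\Delta:=\{(\tau,s)\in\mathbb R^2:\ \tau+s>0,\ \tau\le1,\ -\tau^2-s^2-\tau s+\tau+s+1\ge0\}$. Subroutine xsub. Inputs: $x^k\in\mathcal X$, $\breve x^k$, $h\in\mathbb R^{n_1}$, an integer $m_k\ge1$, $\eta_k>0$, a symmetric matrix $M_k$. Set $x_1=x^k$, $\breve x_1=\breve x^k$. For $t=1,\dots,m_k$: draw $\xi_t$ uniformly from $\{1,\dots,N\}$, independently of everything generated before; set $\beta_t=2/(t+1)$, $\gamma_t=2/(t\eta_k)$, $\hat x_t=\beta_t\breve x_t+(1-\beta_t)x_t$, $d_t=\nabla f_{\xi_t}(\hat x_t)+e_t$ where $e_t$ is a random vector whose conditional expectation given all previously generated random quantities and $\xi_t$ is $0$; $\breve x_{t+1}=\arg\min_{x\in\mathcal X}\{\langle d_t+h,x\rangle+\frac{\gamma_t}2\|x-\breve x_t\|_H^2+\frac12\|x-x^k\|_{M_k}^2\}$; $x_{t+1}=\beta_t\breve x_{t+1}+(1-\beta_t)x_t$. Output $x^{k+1}=x_{m_k+1}$, $\breve x^{k+1}=\breve x_{m_k+1}$. Put $\delta_t=\nabla f(\hat x_t)-d_t$ (inner quantities of outer iteration $k$), and for $x\in\mathcal X$ $$\zeta^k(x)=\frac{2}{m_k(m_k+1)}\Big[\frac1{\eta_k}\big(\|x-\breve x^{k+1}\|_H^2-\|x-\breve x^k\|_H^2\big)-\sum_{t=1}^{m_k}t\langle\delta_t,\breve x_t-x\rangle-\frac{\eta_k}{4(1-\eta_k\nu)}\sum_{t=1}^{m_k}t^2\|\delta_t\|_{H^{-1}}^2\Big].$$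 Algorithm SAS-ADMM. Parameters: $\beta>0$, the matrix $H$, a symmetric positive semidefinite $L\in\mathbb R^{n_2\times n_2}$, $(\tau,s)\in\Delta$. Start: $(x^0,y^0,\lambda^0)\in\mathcal X\times\mathcal Y\times\mathbb R^n$, $\breve x^0=x^0$. For $k=0,1,\dots$: choose an integer $m_k\ge1$, $\eta_k>0$, and a symmetric $M_k$ with $\mathcal D_k:=M_k-\beta A^\top A\succeq0$; set $h^k=-A^\top[\lambda^k-\beta(Ax^k+By^k-b)]$; compute $(x^{k+1},\breve x^{k+1})$ by xsub with inputs $x^k,\breve x^k,h^k,m_k,\eta_k,M_k$; $\lambda^{k+1/2}=\lambda^k-\tau\beta(Ax^{k+1}+By^k-b)$; $y^{k+1}\in\arg\min_{y\in\mathcal Y}\mathcal L_\beta(x^{k+1},y,\lambda^{k+1/2})+\frac12\|y-y^k\|_L^2$ (a minimizer is assumed to exist); $\lambda^{k+1}=\lambda^{k+1/2}-s\beta(Ax^{k+1}+By^{k+1}-b)$. Notation. $\Omega=\mathcal X\times\mathcal Y\times\mathbb R^n$; $w=(x;y;\lambda)$; $F(w)=f(x)+g(y)$; $\mathcal J(w)=(-A^\top\lambda;\,-B^\top\lambda;\,Ax+By-b)$; $w^k=(x^k;y^k;\lambda^k)$; $\tilde\lambda^k=\lambda^k-\beta(Ax^{k+1}+By^k-b)$; $\tilde w^k=(x^{k+1};y^{k+1};\tilde\lambda^k)$. *)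

(* Defs.v *)
From HB Require Import structures.
From mathcomp Require Import all_boot all_order all_algebra.
From mathcomp Require Import all_classical all_reals all_analysis.
Set Implicit Arguments.
Unset Strict Implicit.
Unset Printing Implicit Defensive.
Import Order.TTheory GRing.Theory Num.Theory.
Import numFieldNormedType.Exports.
Local Open Scope classical_set_scope.
Local Open Scope ring_scope.

Section SASADMM.
Variable R : realType.

Definition dotv n (u v : 'cV[R]_n) : R := (u^T *m v) 0 0.
Definition bilin n (u : 'cV[R]_n) (G : 'M[R]_n) (v : 'cV[R]_n) : R :=
  (u^T *m G *m v) 0 0.
Definition sqnormG n (G : 'M[R]_n) (v : 'cV[R]_n) : R := bilin v G v.
Definition sqnorm n (v : 'cV[R]_n) : R := dotv v v.

Definition convex_on n (S : set 'cV[R]_n) (f : 'cV[R]_n -> R) : Prop :=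
  forall u v (t : R), S u -> S v -> 0 <= t <= 1 ->
    f (t *: u + (1 - t) *: v) <= t * f u + (1 - t) * f v.

Definition econvex_on n (S : set 'cV[R]_n) (g : 'cV[R]_n -> \bar R) : Prop :=
  forall u v (t : R), S u -> S v -> 0 < t < 1 ->
    (g (t *: u + (1 - t) *: v)%R <= t%:E * g u + (1 - t)%:E * g v)%E.

Definition proper_on n (S : set 'cV[R]_n) (g : 'cV[R]_n -> \bar R) : Prop :=
  (forall y, S y -> g y != -oo%E) /\ (exists y, S y /\ (g y < +oo)%E).

Definition sym_psd n (G : 'M[R]_n) : Prop :=
  G^T = G /\ forall v : 'cV[R]_n, 0 <= sqnormG G v.

Definition sym_pd n (G : 'M[R]_n) : Prop :=
  G^T = G /\ forall v : 'cV[R]_n, v != 0 -> 0 < sqnormG G v.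

Definition C1_grad_on n (U : set 'cV[R]_n) (f : 'cV[R]_n -> R)
    (Gr : 'cV[R]_n -> 'cV[R]_n) : Prop :=
  forall x, U x ->
    [/\ differentiable f x,
        (forall h, 'd f x h = dotv (Gr x) h) &
        {for x, continuous Gr}].

Definition in_Delta (tau s : R) : Prop :=
  [/\ 0 < tau + s, tau <= 1 & 0 <= - tau ^+ 2 - s ^+ 2 - tau * s + tau + s + 1].

Definition favg n N (f : 'I_N -> 'cV[R]_n -> R) (x : 'cV[R]_n) : R :=
  N%:R^-1 * \sum_(j < N) f j x.
Definition gavg n N (Gr : 'I_N -> 'cV[R]_n -> 'cV[R]_n) (x : 'cV[R]_n)
  : 'cV[R]_n := N%:R^-1 *: \sum_(j < N) Gr j x.

Definition beta_t (t : nat) : R := 2 / (t.+1)%:R.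
Definition gamma_t (eta : R) (t : nat) : R := 2 / (t%:R * eta).

Definition xhat n (xs xbs : nat -> 'cV[R]_n) (t : nat) : 'cV[R]_n :=
  beta_t t *: xbs t + (1 - beta_t t) *: xs t.

Definition dir n N (Gr : 'I_N -> 'cV[R]_n -> 'cV[R]_n) (xi : nat -> 'I_N)
    (e : nat -> 'cV[R]_n) (xs xbs : nat -> 'cV[R]_n) (t : nat) : 'cV[R]_n :=
  Gr (xi t) (xhat xs xbs t) + e t.

Definition delta n N (Gr : 'I_N -> 'cV[R]_n -> 'cV[R]_n) (xi : nat -> 'I_N)
    (e : nat -> 'cV[R]_n) (xs xbs : nat -> 'cV[R]_n) (t : nat) : 'cV[R]_n :=
  gavg Gr (xhat xs xbs t) - dir Gr xi e xs xbs t.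

Definition xsub_obj n N (H : 'M[R]_n) (Gr : 'I_N -> 'cV[R]_n -> 'cV[R]_n)
    (xk h : 'cV[R]_n) (eta : R) (M : 'M[R]_n) (xi : nat -> 'I_N)
    (e : nat -> 'cV[R]_n) (xs xbs : nat -> 'cV[R]_n) (t : nat) (z : 'cV[R]_n) : R :=
  dotv (dir Gr xi e xs xbs t + h) z
  + gamma_t eta t / 2 * sqnormG H (z - xbs t)
  + 1 / 2 * sqnormG M (z - xk).

(* (xs t, xbs t)_{t=1..m+1} is a run of xsub with inputs xk, xbk, h, m, eta, M,
   for the realization (xi t, e t)_{t} of the random quantities. *)
Definition xsub_trace n N (X : set 'cV[R]_n) (H : 'M[R]_n)
    (Gr : 'I_N -> 'cV[R]_n -> 'cV[R]_n)
    (xk xbk h : 'cV[R]_n) (m : nat) (eta : R) (M : 'M[R]_n)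
    (xi : nat -> 'I_N) (e : nat -> 'cV[R]_n) (xs xbs : nat -> 'cV[R]_n) : Prop :=
  [/\ xs 1%N = xk, xbs 1%N = xbk &
      forall t : nat, (1 <= t <= m)%N ->
        [/\ X (xbs t.+1),
            (forall z, X z -> xsub_obj H Gr xk h eta M xi e xs xbs t (xbs t.+1)
                              <= xsub_obj H Gr xk h eta M xi e xs xbs t z) &
            xs t.+1 = beta_t t *: xbs t.+1 + (1 - beta_t t) *: xs t]].

Definition zeta n N (H : 'M[R]_n) (nu : R) (Gr : 'I_N -> 'cV[R]_n -> 'cV[R]_n)
    (xi : nat -> 'I_N) (e : nat -> 'cV[R]_n) (xs xbs : nat -> 'cV[R]_n)
    (m : nat) (eta : R) (xbk xbk1 : 'cV[R]_n) (x : 'cV[R]_n) : R :=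
  2 / (m * m.+1)%:R *
  ( eta^-1 * (sqnormG H (x - xbk1) - sqnormG H (x - xbk))
    - \sum_(1 <= t < m.+1) t%:R * dotv (delta Gr xi e xs xbs t) (xbs t - x)
    - eta / (4 * (1 - eta * nu)) *
        \sum_(1 <= t < m.+1) t%:R ^+ 2 * sqnormG (invmx H) (delta Gr xi e xs xbs t)).

Definition hvec n n1 n2 (A : 'M[R]_(n, n1)) (B : 'M[R]_(n, n2)) (b : 'cV[R]_n)
    (beta : R) (x : 'cV[R]_n1) (y : 'cV[R]_n2) (lam : 'cV[R]_n) : 'cV[R]_n1 :=
  - (A^T *m (lam - beta *: (A *m x + B *m y - b))).

(* augmented Lagrangian L_beta(x,y,lam), with values in \bar R since g may be +oo *)
Definition aug_lag n n1 n2 N (f : 'I_N -> 'cV[R]_n1 -> R) (g : 'cV[R]_n2 -> \bar R)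
    (A : 'M[R]_(n, n1)) (B : 'M[R]_(n, n2)) (b : 'cV[R]_n) (beta : R)
    (x : 'cV[R]_n1) (y : 'cV[R]_n2) (lam : 'cV[R]_n) : \bar R :=
  ((favg f x)%:E + g y
   + (- dotv lam (A *m x + B *m y - b) + beta / 2 * sqnorm (A *m x + B *m y - b))%R%:E)%E.

(* the sequences form a run of SAS-ADMM for the given realization of the
   random draws (xi k t, e k t): outer iterates (x, y, lam, xb), parameters
   (m k, eta k, M k) and inner iterates (xs k t, xbs k t). *)
Definition sas_admm_run n n1 n2 N (X : set 'cV[R]_n1) (Y : set 'cV[R]_n2)
    (A : 'M[R]_(n, n1)) (B : 'M[R]_(n, n2)) (b : 'cV[R]_n)
    (f : 'I_N -> 'cV[R]_n1 -> R) (Gr : 'I_N -> 'cV[R]_n1 -> 'cV[R]_n1)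
    (g : 'cV[R]_n2 -> \bar R) (H : 'M[R]_n1) (L : 'M[R]_n2) (beta tau s : R)
    (x : nat -> 'cV[R]_n1) (y : nat -> 'cV[R]_n2) (lam : nat -> 'cV[R]_n)
    (xb : nat -> 'cV[R]_n1)
    (m : nat -> nat) (eta : nat -> R) (M : nat -> 'M[R]_n1)
    (xi : nat -> nat -> 'I_N) (e : nat -> nat -> 'cV[R]_n1)
    (xs xbs : nat -> nat -> 'cV[R]_n1) : Prop :=
  [/\ X (x 0%N), Y (y 0%N), xb 0%N = x 0%N &
    forall k : nat,
      let lamh := lam k - (tau * beta) *: (A *m x k.+1 + B *m y k - b) in
      (1 <= m k)%N /\ 0 < eta k /\ (M k)^T = M k /\
          sym_psd (M k - beta *: (A^T *m A)) /\
          xsub_trace X H Gr (x k) (xb k) (hvec A B b beta (x k) (y k) (lam k))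
                     (m k) (eta k) (M k) (xi k) (e k) (xs k) (xbs k) /\
          x k.+1 = xs k (m k).+1 /\
          xb k.+1 = xbs k (m k).+1 /\
          Y (y k.+1) /\
          (forall z, Y z ->
             (aug_lag f g A B b beta (x k.+1) (y k.+1) lamh
                + (1 / 2 * sqnormG L (y k.+1 - y k))%R%:E
              <= aug_lag f g A B b beta (x k.+1) z lamh
                + (1 / 2 * sqnormG L (z - y k))%R%:E)%E) /\
          lam k.+1 = lamh - (s * beta) *: (A *m x k.+1 + B *m y k.+1 - b)].

Definition wvec n1 n2 n (x : 'cV[R]_n1) (y : 'cV[R]_n2) (l : 'cV[R]_n)
  : 'cV[R]_(n1 + n2 + n) := col_mx (col_mx x y) l.

Definition Jmap n n1 n2 (A : 'M[R]_(n, n1)) (B : 'M[R]_(n, n2)) (b : 'cV[R]_n)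
    (x : 'cV[R]_n1) (y : 'cV[R]_n2) (l : 'cV[R]_n) : 'cV[R]_(n1 + n2 + n) :=
  col_mx (col_mx (- (A^T *m l)) (- (B^T *m l))) (A *m x + B *m y - b).

Definition Qmat n n1 n2 (D : 'M[R]_n1) (L : 'M[R]_n2) (B : 'M[R]_(n, n2))
    (beta tau : R) : 'M[R]_(n1 + n2 + n) :=
  block_mx (block_mx D 0 0 (L + beta *: (B^T *m B)))
           (col_mx (0 : 'M[R]_(n1, n)) (- (tau *: B^T)))
           (row_mx (0 : 'M[R]_(n, n1)) (- B))
           (beta^-1)%:M.

End SASADMM.

(* Main.v *)
Require Import Defs.
From HB Require Import structures.
From mathcomp Require Import all_boot all_order all_algebra.
From mathcomp Require Import all_classical all_reals all_analysis.
From mathcomp Require Import ring lra.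
Set Implicit Arguments.
Unset Strict Implicit.
Unset Printing Implicit Defensive.
Import Order.TTheory GRing.Theory Num.Theory.
Import numFieldNormedType.Exports.
Local Open Scope classical_set_scope.
Local Open Scope ring_scope.

(* With [Phi v = f v - f u + <h, v - u> + <M (v - x^k), v - u>],
   the descent lemma at [xhat_t], convexity of [f] and of the quadratic part of
   [Phi], optimality of [xbreve_(t+1)], and Young's inequality absorbing
   [<delta_t, xbreve_(t+1) - xbreve_t>] bound [t (t + 1) Phi (x_(t+1))] by
   [(t - 1) t Phi (x_t)] plus terms which telescope; summing over [t] gives
   [- Phi (x^(k+1)) >= zeta^k(u)].  Adding the first-order optimality condition
   of the y-subproblem, the rest is an identity between bilinear forms, in which
   [J] may be evaluated at [w] since its linear part is skew. *)

(** * Algebra of inner products, quadratic forms and positive definite matrices *)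

Lemma dotvC (R : realType) n (u v : 'cV[R]_n) : dotv u v = dotv v u.
Proof.
have <- : (v^T *m u)^T 0 0 = dotv u v by rewrite trmx_mul trmxK.
by rewrite /dotv mxE.
Qed.

Lemma dotvDr (R : realType) n (u v w : 'cV[R]_n) :
  dotv u (v + w) = dotv u v + dotv u w.
Proof. by rewrite /dotv mulmxDr mxE. Qed.

Lemma dotvNr (R : realType) n (u v : 'cV[R]_n) : dotv u (- v) = - dotv u v.
Proof. by rewrite /dotv mulmxN mxE. Qed.

Lemma dotvZr (R : realType) n a (u v : 'cV[R]_n) :
  dotv u (a *: v) = a * dotv u v.
Proof. by rewrite /dotv -scalemxAr mxE. Qed.

Lemma dotv0r (R : realType) n (u : 'cV[R]_n) : dotv u 0 = 0.
Proof. by rewrite /dotv mulmx0 mxE. Qed.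

Lemma dotvDl (R : realType) n (u v w : 'cV[R]_n) :
  dotv (u + v) w = dotv u w + dotv v w.
Proof. by rewrite dotvC dotvDr !(dotvC w). Qed.

Lemma dotvNl (R : realType) n (u v : 'cV[R]_n) : dotv (- u) v = - dotv u v.
Proof. by rewrite dotvC dotvNr dotvC. Qed.

Lemma dotvZl (R : realType) n a (u v : 'cV[R]_n) :
  dotv (a *: u) v = a * dotv u v.
Proof. by rewrite dotvC dotvZr dotvC. Qed.

Lemma dotv_suml (R : realType) n (I : Type) (r : seq I) (F : I -> 'cV[R]_n)
    (v : 'cV[R]_n) :
  dotv (\sum_(i <- r) F i) v = \sum_(i <- r) dotv (F i) v.
Proof.
apply: (big_morph (fun u => dotv u v)) => [u w|]; first exact: dotvDl.
by rewrite dotvC dotv0r.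
Qed.

Lemma dotv_trmxl (R : realType) n p (G : 'M[R]_(n, p)) u v :
  dotv (G^T *m u) v = dotv u (G *m v).
Proof. by rewrite /dotv trmx_mul trmxK mulmxA. Qed.

Lemma dotv_col_mx (R : realType) n p (u1 v1 : 'cV[R]_n) (u2 v2 : 'cV[R]_p) :
  dotv (col_mx u1 u2) (col_mx v1 v2) = dotv u1 v1 + dotv u2 v2.
Proof. by rewrite /dotv tr_col_mx mul_row_col mxE. Qed.

Lemma bilinE (R : realType) n (u : 'cV[R]_n) G v :
  bilin u G v = dotv u (G *m v).
Proof. by rewrite /bilin /dotv mulmxA. Qed.

Lemma sqnormGE (R : realType) n (G : 'M[R]_n) v :
  sqnormG G v = dotv v (G *m v).
Proof. exact: bilinE. Qed.

Lemma dotv_symmx (R : realType) n (G : 'M[R]_n) u v :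
  G^T = G -> dotv u (G *m v) = dotv v (G *m u).
Proof. by move=> Gs; rewrite -dotv_trmxl Gs dotvC. Qed.

Lemma sqnormGZ (R : realType) n (G : 'M[R]_n) a v :
  sqnormG G (a *: v) = a ^+ 2 * sqnormG G v.
Proof. by rewrite !sqnormGE -scalemxAr dotvZl dotvZr; ring. Qed.

Lemma sqnormGD (R : realType) n (G : 'M[R]_n) u v : G^T = G ->
  sqnormG G (u + v) = sqnormG G u + 2 * dotv (G *m u) v + sqnormG G v.
Proof.
move=> Gs; rewrite !sqnormGE mulmxDr !(dotvDl, dotvDr).
by rewrite (dotv_symmx u v Gs) (dotvC _ v); ring.
Qed.

Lemma sqnormG_line (R : realType) n (G : 'M[R]_n) u v t : G^T = G ->
  sqnormG G (u + t *: v)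
  = sqnormG G u + t * (2 * dotv (G *m u) v) + t ^+ 2 * sqnormG G v.
Proof. by move=> Gs; rewrite sqnormGD// sqnormGZ dotvZr; ring. Qed.

Lemma sym_pd_psd (R : realType) n (G : 'M[R]_n) : sym_pd G -> sym_psd G.
Proof.
case=> Gs Gp; split=> // v; have [->|/Gp/ltW//] := eqVneq v 0.
by rewrite sqnormGE mulmx0 dotv0r.
Qed.

(** A nonzero row [v] of the left kernel would give [v G v^T = 0], contradicting definiteness. *)
Lemma sym_pd_unit (R : realType) n (G : 'M[R]_n) : sym_pd G -> G \in unitmx.
Proof.
case=> Gs Gp; rewrite -row_free_unit -kermx_eq0; apply/eqP/row_matrixP => i.
rewrite row0; apply/eqP; apply: contraT => ri0.
have : (row i (kermx G))^T != 0 by rewrite -trmx0 (inj_eq (can_inj (@trmxK _ _ _))).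
by move=> /Gp; rewrite /sqnormG /bilin trmxK -row_mul mulmx_ker row0 mul0mx mxE ltxx.
Qed.

Lemma sqnormG_inv (R : realType) n (G : 'M[R]_n) v : sym_pd G ->
  sqnormG (invmx G) v = sqnormG G (invmx G *m v).
Proof.
move=> Gp; have Gu := sym_pd_unit Gp.
by rewrite !sqnormGE (mulmxA G) mulmxV// mul1mx dotvC.
Qed.

Lemma sqnormG_inv_ge0 (R : realType) n (G : 'M[R]_n) v : sym_pd G ->
  0 <= sqnormG (invmx G) v.
Proof. by move=> Gp; rewrite sqnormG_inv//; apply: (sym_pd_psd Gp).2. Qed.

(* Expand [0 <= || c G^-1 u - v ||_G^2]. *)
Lemma dotv_young (R : realType) n (G : 'M[R]_n) u v c : sym_pd G -> 0 < c ->
  dotv u v <= c / 2 * sqnormG (invmx G) u + (2 * c)^-1 * sqnormG G v.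
Proof.
move=> Gp c0; have Gu := sym_pd_unit Gp.
have := (sym_pd_psd Gp).2 (v + - c *: (invmx G *m u)).
rewrite sqnormG_line ?Gp.1// -sqnormG_inv//.
have -> : dotv (G *m v) (invmx G *m u) = dotv u v.
  by rewrite dotvC -(dotv_symmx _ _ Gp.1) mulmxA mulmxV// mul1mx dotvC.
move=> h; rewrite -subr_ge0.
have -> : c / 2 * sqnormG (invmx G) u + (2 * c)^-1 * sqnormG G v - dotv u v
  = (2 * c)^-1 * (sqnormG G v + - c * (2 * dotv u v) + (- c) ^+ 2 * sqnormG (invmx G) u).
  by field; rewrite gt_eqF.
by rewrite mulr_ge0// invr_ge0 mulr_ge0// ltW.
Qed.

(** * First-order conditions, tangents and the descent inequality *)

(** Replaces dividing by [t] and letting [t] tend to [0]: it extracts first-order conditions from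
    minimality along a segment. *)
Lemma ge0_of_quadratic (R : realType) (a c : R) :
  (forall t, 0 < t < 1 -> 0 <= t * a + t ^+ 2 * c) -> 0 <= a.
Proof.
move=> h; rewrite leNgt; apply/negP => a0.
have d0 : 0 < 2 * (`|c| - a) by have := normr_ge0 c; lra.
(* This choice gives [t * (|c| - a) = - a / 2], hence [a + t * c <= a / 2 + t * a < 0]. *)
pose t := - a / (2 * (`|c| - a)).
have t01 : 0 < t < 1.
  rewrite divr_gt0 ?oppr_gt0//= ltr_pdivrMr// mul1r.
  by have := normr_ge0 c; lra.
have := h t t01; case/andP: t01 => t0 _.
rewrite expr2 -mulrA -mulrDr pmulr_rge0//.
have tE : t * (2 * (`|c| - a)) = - a by rewrite /t divfK// gt_eqF.
have : t * c <= t * `|c| by rewrite ler_pM2l// ler_norm.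
have : 0 < t * - a by rewrite mulr_gt0// oppr_gt0.
lra.
Qed.

Lemma convex_set_line (R : realType) n (S : set 'cV[R]_n) u v t :
  convex_set S -> S u -> S v -> 0 <= t <= 1 -> S (t *: u + (1 - t) *: v).
Proof.
move=> cS Su Sv /andP[t0 t1].
by have := cS u v (Itv01 t0 t1) (mem_set Su) (mem_set Sv) => /set_mem.
Qed.

(** At [t], the difference quotient of the restriction is the directional quotient of [f] at
    [p + t *: d]. *)
Lemma is_derive_line (R : realType) n (f : 'cV[R]_n -> R) (p d : 'cV[R]_n) (t : R) :
  differentiable f (p + t *: d) ->
  is_derive t 1 (fun r : R => f (p + r *: d)) ('d f (p + t *: d) d).
Proof.
move=> df.
have E : (fun h : R => h^-1 *: (((fun r : R => f (p + r *: d)) \o shift t) (h *: 1)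
            - f (p + t *: d)))
       = (fun h : R => h^-1 *: ((f \o shift (p + t *: d)) (h *: d) - f (p + t *: d))).
  apply/funext => h /=; congr (_ *: (f _ - _)).
  by rewrite [_%:A]mulr1 scalerDl addrCA.
apply: DeriveDef.
  by rewrite /derivable E; exact: diff_derivable.
by rewrite /derive E -deriveE.
Qed.

(** Convexity bounds each quotient [(f (p + t (q - p)) - f p) / t], [0 < t < 1], by [f q - f p]; the
    derivative is their limit from the right. *)
Lemma convex_above_tangent (R : realType) n (S : set 'cV[R]_n) f (p q : 'cV[R]_n) :
  convex_on S f -> S p -> S q -> differentiable f p ->
  f p + 'd f p (q - p) <= f q.
Proof.
move=> cf Sp Sq df; rewrite -lerBrDl -deriveE//.
have dv : derivable f p (q - p) by exact: diff_derivable.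
have dc := cvg_dnbhs_at_right dv.
rewrite /derive -(cvg_lim _ dc)//.
apply: limr_le; first exact: cvgP dc.
near=> t.
have t0 : 0 < t by near: t; exact: nbhs_right_gt.
have t1 : t < 1 by near: t; exact: nbhs_right_lt.
rewrite /= [_ *: _]mulrC ler_pdivrMr//.
have := cf q p t Sq Sp; rewrite (ltW t0) (ltW t1) => /(_ isT).
have -> : t *: q + (1 - t) *: p = t *: (q - p) + p.
  by rewrite scalerBl scale1r scalerBr addrCA addrC.
by move=> h; lra.
Unshelve. all: by end_near. Qed.

(** The claim is [psi 1 <= psi 0], where [psi] is [f] along the segment minus the linear and
    quadratic parts of the bound. The mean value theorem replaces integration: the derivative of
    [psi] is nonpositive at interior points by the Lipschitz condition. *)
Lemma descent_lemma (R : realType) n (S : set 'cV[R]_n) f Gr (H : 'M[R]_n)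
    (nu : R) (p q : 'cV[R]_n) :
  convex_set S -> sym_pd H -> 0 < nu ->
  (forall z, S z -> differentiable f z) ->
  (forall z, S z -> forall h, 'd f z h = dotv (Gr z) h) ->
  (forall z1 z2, S z1 -> S z2 -> Num.sqrt (sqnormG (invmx H) (Gr z1 - Gr z2))
      <= nu * Num.sqrt (sqnormG H (z1 - z2))) ->
  S p -> S q ->
  f q <= f p + dotv (Gr p) (q - p) + nu / 2 * sqnormG H (q - p).
Proof.
move=> cS Hp nu0 df dfE lip Sp Sq.
set d := q - p; set c := sqnormG H d.
have c0 : 0 <= c by exact: (sym_pd_psd Hp).2.
have Sl (t : R) : 0 <= t <= 1 -> S (p + t *: d).
  move=> t01; have -> : p + t *: d = t *: q + (1 - t) *: p.
    by rewrite scalerBl scale1r scalerBr addrCA.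
  exact: convex_set_line.
pose psi (r : R) := f (p + r *: d) - (dotv (Gr p) d * r + nu / 2 * c * r ^+ 2).
have dpsi (t : R) : 0 <= t <= 1 ->
    is_derive t 1 psi (dotv (Gr (p + t *: d)) d - (dotv (Gr p) d + nu * c * t)).
  move=> t01; have Slt := Sl _ t01.
  have h1 := is_derive_line (df _ Slt); rewrite dfE// in h1.
  have h2 : is_derive t 1 (fun r : R => dotv (Gr p) d * r + nu / 2 * c * r ^+ 2)
              (dotv (Gr p) d + nu * c * t).
    apply: is_derive_eq; rewrite /GRing.scale/=; lra.
  exact: (is_deriveB h1 h2).
have cont : {within `[0, 1], continuous psi}.
  apply: derivable_within_continuous => t; rewrite in_itv/= => t01.
  exact: (@ex_derive _ _ _ _ _ _ _ (dpsi t t01)).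
have [t t01 psiE] : exists2 t, t \in `]0, 1[ & psi 1 - psi 0 =
    (dotv (Gr (p + t *: d)) d - (dotv (Gr p) d + nu * c * t)) * (1 - 0).
  apply: (MVT ltr01) cont => t; rewrite in_itv/= => /andP[t0 t1].
  by apply: dpsi; rewrite !ltW.
move: t01; rewrite in_itv/= => /andP[t0 t1].
have Slt : S (p + t *: d) by apply: Sl; rewrite !ltW.
suff : dotv (Gr (p + t *: d) - Gr p) d <= nu * t * c.
  rewrite dotvDl dotvNl; move: psiE; rewrite /psi.
  rewrite !(scale0r, scale1r, addr0) /d [p + _]addrC subrK -/d; lra.
have lipt := lip _ _ Slt Sp.
rewrite [X in _ * Num.sqrt (sqnormG H X)]addrC addKr sqnormGZ in lipt.
rewrite sqrtrM ?sqr_ge0// sqrtr_sqr gtr0_norm// -/c mulrA in lipt.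
set u := _ - _ in lipt *.
have uc : sqnormG (invmx H) u <= (nu * t) ^+ 2 * c.
  have : Num.sqrt (sqnormG (invmx H) u) ^+ 2 <= (nu * t * Num.sqrt c) ^+ 2.
    by apply: lerXn2r lipt; rewrite nnegrE ?mulr_ge0 ?sqrtr_ge0// ltW.
  by rewrite exprMn !sqr_sqrtr// sqnormG_inv_ge0.
have nt0 : 0 < nu * t by rewrite mulr_gt0.
(* Young's inequality with weight [(nu * t)^-1] gives two terms, each at most [nu * t * c / 2]. *)
have iv0 : 0 < (nu * t)^-1 by rewrite invr_gt0.
apply: le_trans (dotv_young u d Hp iv0) _; rewrite -/c.
have -> : (2 * (nu * t)^-1)^-1 * c = nu * t * c - nu * t / 2 * c.
  by field; rewrite !gt_eqF.
have : (nu * t)^-1 / 2 * sqnormG (invmx H) u <= (nu * t)^-1 / 2 * ((nu * t) ^+ 2 * c).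
  by rewrite ler_pM2l// divr_gt0.
have -> : (nu * t)^-1 / 2 * ((nu * t) ^+ 2 * c) = nu * t / 2 * c.
  by field; rewrite !gt_eqF.
lra.
Qed.

(** * Passage from the components [f j] to their average *)

Lemma dotv_gavg (R : realType) n N (Gr : 'I_N -> 'cV[R]_n -> 'cV[R]_n) p v :
  dotv (gavg Gr p) v = N%:R^-1 * \sum_j dotv (Gr j p) v.
Proof. by rewrite /gavg dotvZl dotv_suml. Qed.

Lemma favg_above_tangent (R : realType) n N (f : 'I_N -> 'cV[R]_n -> R) Gr p q :
  (forall j, f j p + dotv (Gr j p) (q - p) <= f j q) ->
  favg f p + dotv (gavg Gr p) (q - p) <= favg f q.
Proof.
move=> h; rewrite dotv_gavg /favg -mulrDr -big_split/=.
by rewrite ler_wpM2l ?invr_ge0//; apply: ler_sum => j _.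
Qed.

Lemma favg_descent (R : realType) n N (f : 'I_N -> 'cV[R]_n -> R) Gr p q c :
  (0 < N)%N ->
  (forall j, f j q <= f j p + dotv (Gr j p) (q - p) + c) ->
  favg f q <= favg f p + dotv (gavg Gr p) (q - p) + c.
Proof.
move=> N0 h.
have -> : c = N%:R^-1 * \sum_(j < N) c.
  by rewrite sumr_const card_ord -[c *+ N]mulr_natl mulKf// pnatr_eq0 -lt0n.
rewrite dotv_gavg /favg -!mulrDr -!big_split/=.
by rewrite ler_wpM2l ?invr_ge0//; apply: ler_sum => j _.
Qed.

(** * One inner iteration of the x-subroutine *)

(** Moving from [z] to [z + t (u - z)] changes the objective by [t] times the asserted quantity plus
    a multiple of [t ^+ 2]. *)
Lemma prox_optimality (R : realType) n (S : set 'cV[R]_n) (G M : 'M[R]_n)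
    (c p q z u : 'cV[R]_n) (a : R) :
  convex_set S -> G^T = G -> M^T = M -> S z -> S u ->
  (forall v, S v ->
    dotv c z + a / 2 * sqnormG G (z - p) + 1 / 2 * sqnormG M (z - q) <=
    dotv c v + a / 2 * sqnormG G (v - p) + 1 / 2 * sqnormG M (v - q)) ->
  0 <= dotv c (u - z) + a * dotv (G *m (z - p)) (u - z)
       + dotv (M *m (z - q)) (u - z).
Proof.
move=> cS Gs Ms Sz Su zmin.
apply: (@ge0_of_quadratic _ _
  (a / 2 * sqnormG G (u - z) + 1 / 2 * sqnormG M (u - z))) => t /andP[t0 t1].
have t01 : 0 <= t <= 1 by rewrite !ltW.
have := zmin _ (convex_set_line cS Su Sz t01).
have -> : t *: u + (1 - t) *: z = z + t *: (u - z).
  by rewrite scalerBl scale1r scalerBr addrCA.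
rewrite ![z + t *: _ - _]addrAC !sqnormG_line// dotvDr dotvZr; lra.
Qed.

(** Polarization for [u - p = (z - p) + (u - z)]. *)
Lemma three_points (R : realType) n (G : 'M[R]_n) (u z p : 'cV[R]_n) :
  G^T = G ->
  2 * dotv (G *m (z - p)) (u - z)
  = sqnormG G (u - p) - sqnormG G (z - p) - sqnormG G (u - z).
Proof.
by move=> Gs; have := sqnormGD (z - p) (u - z) Gs; rewrite addrC addrA subrK; lra.
Qed.

(** The right side exceeds the left by exactly [t (1 - t) ||a - c||_M^2]. *)
Lemma dotv_quad_convex (R : realType) n (M : 'M[R]_n) (a c q u : 'cV[R]_n) t :
  sym_psd M -> 0 <= t <= 1 ->
  dotv (M *m (t *: a + (1 - t) *: c - q)) (t *: a + (1 - t) *: c - u)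
  <= t * dotv (M *m (a - q)) (a - u) + (1 - t) * dotv (M *m (c - q)) (c - u).
Proof.
move=> [Ms Mp] /andP[t0 t1].
have : 0 <= t * (1 - t) * sqnormG M (a - c).
  by rewrite mulr_ge0// mulr_ge0// subr_ge0.
rewrite sqnormGE !(mulmxDr, mulmxN) -!scalemxAr.
rewrite !(dotvDl, dotvDr, dotvNl, dotvNr, dotvZl, dotvZr).
rewrite (dotvC a (M *m a)) (dotvC a (M *m c)) (dotvC c (M *m a)) (dotvC c (M *m c)).
lra.
Qed.

(** This is [Phi]. Its [M]-term is the pairing that occurs in the optimality condition, not a
    difference of squared norms, so that the final bound fits the bilinear identity directly. *)
Definition xsub_gap (R : realType) n (F : 'cV[R]_n -> R) (h xk : 'cV[R]_n)
    (M : 'M[R]_n) (u v : 'cV[R]_n) : R :=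
  F v - F u + dotv h (v - u) + dotv (M *m (v - xk)) (v - u).

(** Descent from [p] to [x'] bounds [F x']; the tangent at [p] is compared with [F] at [x0] and [u],
    and the remaining pairing with [xb' - u] is controlled by optimality of [xb']. *)
Lemma xsub_gap_step (R : realType) n (S : set 'cV[R]_n) (F : 'cV[R]_n -> R)
    (G : 'cV[R]_n -> 'cV[R]_n) (H M : 'M[R]_n) (nu b a : R)
    (h xk d x0 xb xb' u : 'cV[R]_n) :
  let p := b *: xb + (1 - b) *: x0 in
  let x' := b *: xb' + (1 - b) *: x0 in
  convex_set S -> H^T = H -> sym_psd M -> 0 <= b <= 1 ->
  (forall v w, S v -> S w -> F v + dotv (G v) (w - v) <= F w) ->
  (forall v w, S v -> S w ->
     F w <= F v + dotv (G v) (w - v) + nu / 2 * sqnormG H (w - v)) ->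
  S x0 -> S xb -> S xb' -> S u ->
  (forall v, S v ->
    dotv (d + h) xb' + a / 2 * sqnormG H (xb' - xb) + 1 / 2 * sqnormG M (xb' - xk) <=
    dotv (d + h) v + a / 2 * sqnormG H (v - xb) + 1 / 2 * sqnormG M (v - xk)) ->
  xsub_gap F h xk M u x' <= (1 - b) * xsub_gap F h xk M u x0
    + b * (a / 2 * (sqnormG H (u - xb) - sqnormG H (u - xb'))
           + dotv (G p - d) (xb - u) + dotv (G p - d) (xb' - xb)
           + (nu * b / 2 - a / 2) * sqnormG H (xb' - xb)).
Proof.
move=> p x' cS Hs Mp b01 tang desc Sx Sxb Sxb' Su xmin.
have Sp : S p by exact: convex_set_line.
have Sx' : S x' by exact: convex_set_line.
have A1 := desc _ _ Sp Sx'.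
(* This factor turns the descent term into [nu * b ^+ 2 / 2]; one [b] is factored out in the
   goal. *)
have E : x' - p = b *: (xb' - xb).
  by rewrite /x' /p opprD addrACA subrr addr0 scalerBr.
rewrite E sqnormGZ in A1.
have A2 := tang _ _ Sp Sx; have A3 := tang _ _ Sp Su.
have A4 := prox_optimality cS Hs Mp.1 Sxb' Su xmin.
have A5 := three_points u xb' xb Hs.
have A7 := dotv_quad_convex xb' x0 xk u Mp b01.
rewrite /xsub_gap -/x' in A7 *.
case/andP: b01 => b0 b1; have b1' : 0 <= 1 - b by rewrite subr_ge0.
rewrite -subr_ge0 in A2; rewrite -subr_ge0 in A3.
(* Multiplying by the weights here leaves only a linear combination for the end. *)
have B2 := mulr_ge0 b1' A2; have B3 := mulr_ge0 b0 A3; have B4 := mulr_ge0 b0 A4.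
have -> : dotv h (x' - u) = b * dotv h (xb' - u) + (1 - b) * dotv h (x0 - u).
  by rewrite /x' !(dotvDr, dotvNr, dotvZr); ring.
have A8 : dotv (G p) (b *: (xb' - xb)) = (1 - b) * dotv (G p) (x0 - p) 
    + b * dotv (G p) (u - p) + b * dotv (G p) (xb' - u).
  rewrite -!dotvZr -!dotvDr -E /x' /p; congr dotv.
  apply/matrixP => i j; rewrite !mxE; ring.
rewrite A8 in A1.
have A9 : dotv (M *m (xb' - xk)) (u - xb') = - dotv (M *m (xb' - xk)) (xb' - u).
  by rewrite -dotvNr opprB.
have A10 : dotv (d + h) (u - xb') = - dotv d (xb' - u) - dotv h (xb' - u).
  by rewrite -[u - xb']opprB dotvNr dotvDl opprD.
have A11 : dotv (G p - d) (xb - u) + dotv (G p - d) (xb' - xb)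
    = dotv (G p) (xb' - u) - dotv d (xb' - u).
  by rewrite -dotvDr [xb - u + _]addrC addrA subrK dotvDl dotvNl.
have A12 : a * dotv (H *m (xb' - xb)) (u - xb') =
   a / 2 * (sqnormG H (u - xb) - sqnormG H (xb' - xb) - sqnormG H (u - xb')).
  by rewrite -A5; field.
rewrite A9 A10 A12 in B4.
rewrite -[X in _ <= _ + _ * (X + _)]addrA A11.
lra.
Qed.

(** As [beta_t = 2 / (t + 1)], one has [t (t + 1) (1 - beta_t) = (t - 1) t], so the gaps telescope;
    [t (t + 1) beta_t gamma_t / 2 = 2 / eta] is free of [t], so the distances telescope as well. *)
Lemma xsub_gap_weighted_step (R : realType) n (S : set 'cV[R]_n) (F : 'cV[R]_n -> R)
    (G : 'cV[R]_n -> 'cV[R]_n) (H M : 'M[R]_n) (nu eta : R) (t : nat)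
    (h xk d x0 xb xb' u : 'cV[R]_n) :
  let p := beta_t R t *: xb + (1 - beta_t R t) *: x0 in
  let x' := beta_t R t *: xb' + (1 - beta_t R t) *: x0 in
  (0 < t)%N -> 0 < eta -> 0 < nu -> eta * nu < 1 ->
  convex_set S -> sym_pd H -> sym_psd M ->
  (forall v w, S v -> S w -> F v + dotv (G v) (w - v) <= F w) ->
  (forall v w, S v -> S w ->
     F w <= F v + dotv (G v) (w - v) + nu / 2 * sqnormG H (w - v)) ->
  S x0 -> S xb -> S xb' -> S u ->
  (forall v, S v ->
    dotv (d + h) xb' + gamma_t eta t / 2 * sqnormG H (xb' - xb)
      + 1 / 2 * sqnormG M (xb' - xk) <=
    dotv (d + h) v + gamma_t eta t / 2 * sqnormG H (v - xb)
      + 1 / 2 * sqnormG M (v - xk)) ->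
  (t * t.+1)%:R * xsub_gap F h xk M u x'
  <= (t.-1 * t)%:R * xsub_gap F h xk M u x0
     + 2 * (eta^-1 * (sqnormG H (u - xb) - sqnormG H (u - xb'))
            + t%:R * dotv (G p - d) (xb - u)
            + eta / (4 * (1 - eta * nu))
              * (t%:R ^+ 2 * sqnormG (invmx H) (G p - d))).
Proof.
move=> p x' t0 eta0 nu0 en cS Hp Mp tang desc Sx Sxb Sxb' Su xmin.
have T1 : 1 <= t%:R :> R by rewrite ler1n.
have bE : beta_t R t = 2 / (t%:R + 1) by rewrite /beta_t -[t.+1%:R]natr1.
set T : R := t%:R in T1 bE *.
have T0 : 0 < T by exact: lt_le_trans T1.
have T10 : 0 < T + 1 by lra.
have b01 : 0 <= beta_t R t <= 1.
  rewrite bE; apply/andP; split; first by rewrite divr_ge0// ltW.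
  by rewrite ler_pdivrMr//; lra.
have := xsub_gap_step cS Hp.1 Mp b01 tang desc Sx Sxb Sxb' Su xmin.
rewrite -/p -/x'.
set de := G p - d.
pose c := T * eta / (2 * (1 - eta * nu)).
have en0 : 0 < 1 - eta * nu by rewrite subr_gt0.
have c0 : 0 < c by rewrite divr_gt0 ?mulr_gt0.
have Y := dotv_young de (xb' - xb) Hp c0.
have Dl0 : 0 <= sqnormG H (xb' - xb) by exact: (sym_pd_psd Hp).2.
set Dl := sqnormG H (xb' - xb) in Y Dl0 *.
set V := sqnormG (invmx H) de in Y *.
move: (xsub_gap F h xk M u x') (xsub_gap F h xk M u x0) => P' P0.
move: (sqnormG H (u - xb)) (sqnormG H (u - xb')) (dotv de (xb - u)) => S0 S1 W.
set Z := dotv de (xb' - xb) in Y *.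
have -> : (t * t.+1)%:R = T * (T + 1) :> R by rewrite natrM -natr1.
(* [0 < t] makes [t.-1] a true predecessor; the coefficient vanishes at [t = 1]. *)
have -> : (t.-1 * t)%:R = (T - 1) * T :> R.
  by rewrite natrM; congr (_ * _); rewrite /T -[in RHS](prednK t0) -natr1 addrK.
rewrite bE /gamma_t -/T => step.
have sc : nu * (2 / (T + 1)) / 2 - 2 / (T * eta) / 2 + (2 * c)^-1 <= 0.
  have -> : nu * (2 / (T + 1)) / 2 - 2 / (T * eta) / 2 + (2 * c)^-1
     = - (nu / (T * (T + 1))).
    by rewrite /c; field; rewrite !gt_eqF.
  by rewrite oppr_le0 divr_ge0 ?mulr_ge0 ?ltW.
have sD : (nu * (2 / (T + 1)) / 2 - 2 / (T * eta) / 2 + (2 * c)^-1) * Dl <= 0.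
  by rewrite mulr_le0_ge0.
have step' : P' <= (1 - 2 / (T + 1)) * P0 + 2 / (T + 1) *
     (2 / (T * eta) / 2 * (S0 - S1) + W + c / 2 * V).
  apply: le_trans step _; rewrite lerD2l ler_pM2l ?divr_gt0//.
  lra.
have TT0 : 0 < T * (T + 1) by rewrite mulr_gt0.
rewrite -(ler_pM2l TT0) in step'.
apply: le_trans step' _.
rewrite le_eqVlt; apply/orP; left; apply/eqP; rewrite /c; field.
by rewrite !gt_eqF.
Qed.

(** * Summation over the inner iterations *)

Lemma beta_t_itv (R : realType) t : (0 < t)%N -> 0 <= beta_t R t <= 1.
Proof.
move=> t0; rewrite /beta_t divr_ge0//= ler_pdivrMr// mul1r.
by rewrite (ler_nat R 2 t.+1).
Qed.

(** Each new [xs] is a convex combination of feasible points; the index shift makes [t = 0] the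
    starting pair. *)
Lemma xsub_trace_mem (R : realType) n N (S : set 'cV[R]_n) (H : 'M[R]_n)
    (Gr : 'I_N -> 'cV[R]_n -> 'cV[R]_n) xk xbk h m eta (M : 'M[R]_n) xi e xs xbs t :
  convex_set S -> xsub_trace S H Gr xk xbk h m eta M xi e xs xbs ->
  S xk -> S xbk -> (t <= m)%N -> S (xs t.+1) /\ S (xbs t.+1).
Proof.
move=> cS [x1 xb1 step] Sx Sxb; elim: t => [_|t IH tm]; first by rewrite x1 xb1.
have [Sxb' _ ->] := step t.+1 tm.
have [Sx' _] := IH (ltnW tm).
by split=> //; apply: convex_set_line => //; exact: beta_t_itv.
Qed.

(** The weighted steps are summed; the starting gap has weight [0], and dividing the total by
    [m (m + 1)] leaves [- zeta]. *)
Lemma xsub_gap_le_zeta (R : realType) n N (S : set 'cV[R]_n)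
    (f : 'I_N -> 'cV[R]_n -> R) (Gr : 'I_N -> 'cV[R]_n -> 'cV[R]_n)
    (H M : 'M[R]_n) (nu eta : R) xk xbk h m xi e xs xbs u :
  (0 < m)%N -> 0 < eta -> 0 < nu -> eta * nu < 1 ->
  convex_set S -> sym_pd H -> sym_psd M ->
  (forall v w, S v -> S w ->
     favg f v + dotv (gavg Gr v) (w - v) <= favg f w) ->
  (forall v w, S v -> S w ->
     favg f w <= favg f v + dotv (gavg Gr v) (w - v) + nu / 2 * sqnormG H (w - v)) ->
  S xk -> S xbk -> S u ->
  xsub_trace S H Gr xk xbk h m eta M xi e xs xbs ->
  xsub_gap (favg f) h xk M u (xs m.+1)
  <= - zeta H nu Gr xi e xs xbs m eta xbk (xbs m.+1) u.
Proof.
move=> m0 eta0 nu0 en cS Hp Mp tang desc Sx Sxb Su tr.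
have mem t := xsub_trace_mem (t := t) cS tr Sx Sxb.
have [_ xb1 step] := tr.
suff sum j : (j <= m)%N ->
    (j * j.+1)%:R * xsub_gap (favg f) h xk M u (xs j.+1)
    <= 2 * (eta^-1 * (sqnormG H (u - xbk) - sqnormG H (u - xbs j.+1))
      + \sum_(1 <= t < j.+1) t%:R * dotv (delta Gr xi e xs xbs t) (xbs t - u)
      + eta / (4 * (1 - eta * nu)) * \sum_(1 <= t < j.+1)
          t%:R ^+ 2 * sqnormG (invmx H) (delta Gr xi e xs xbs t)).
  have mm0 : 0 < (m * m.+1)%:R :> R by rewrite ltr0n muln_gt0 m0.
  rewrite -(ler_pM2l mm0); apply: le_trans (sum m (leqnn m)) _.
  rewrite /zeta le_eqVlt; apply/orP; left; apply/eqP.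
  rewrite mulrN (mulrA _ (2 / _)) (mulrCA _ 2) divff ?gt_eqF//; ring.
elim: j => [_|j IH jm].
  (* For [j = 0] the sums are empty and [xbs 1 = xbk] cancels the distances. *)
  by rewrite !big_nil xb1 mul0n mul0r; lra.
have {IH} := IH (ltnW jm).
have [Sx' Sxb'] := mem j (ltnW jm).
have [Sxb'' xmin xE] := step j.+1 jm.
have := xsub_gap_weighted_step (t := j.+1) isT eta0 nu0 en cS Hp Mp tang desc
  Sx' Sxb' Sxb'' Su xmin.
rewrite -xE -/(xhat xs xbs j.+1) -/(delta Gr xi e xs xbs j.+1).
rewrite [X in _ -> _ -> _ <= 2 * (_ + X + _)]big_nat_recr//=.
rewrite [X in _ -> _ -> _ <= 2 * (_ + _ * X)]big_nat_recr//=.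
rewrite (mulrDr (eta / _)).
move: (\sum_(1 <= t < j.+1) _) (\sum_(1 <= t < j.+1) _) => s1 s2.
set c := eta / _ * _; lra.
Qed.

(** * Feasibility of the outer iterates, and the y-subproblem *)

Lemma sas_admm_run_mem (R : realType) n n1 n2 N (X : set 'cV[R]_n1) Y
    (A : 'M[R]_(n, n1)) (B : 'M[R]_(n, n2)) b (f : 'I_N -> _) Gr g H L beta tau s
    x y lam xb m eta M xi e xs xbs k :
  convex_set X ->
  sas_admm_run X Y A B b f Gr g H L beta tau s x y lam xb m eta M xi e xs xbs ->
  X (x k) /\ X (xb k).
Proof.
move=> cX [X0 _ xb0 run]; elim: k => [|k [Xk Xbk]]; first by rewrite xb0.
have [m0 [_ [_ [_ [tr [-> [-> _]]]]]]] := run k.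
exact: xsub_trace_mem cX tr Xk Xbk _.
Qed.

Lemma sqnorm_line (R : realType) n (u v : 'cV[R]_n) t :
  sqnorm (u + t *: v) = sqnorm u + t * (2 * dotv u v) + t ^+ 2 * sqnorm v.
Proof.
by rewrite /sqnorm !(dotvDl, dotvDr, dotvZl, dotvZr) (dotvC v u); ring.
Qed.

(** Properness supplies a point with finite [g]; were [g z = +oo], that point would have a smaller
    objective. *)
Lemma aug_lag_argmin_fin (R : realType) n n1 n2 N (Y : set 'cV[R]_n2)
    (f : 'I_N -> 'cV[R]_n1 -> R) g (A : 'M[R]_(n, n1)) (B : 'M[R]_(n, n2)) b beta
    x lam z (q : 'cV[R]_n2 -> R) :
  proper_on Y g -> Y z ->
  (forall v, Y v -> (aug_lag f g A B b beta x z lam + (q z)%:E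
                     <= aug_lag f g A B b beta x v lam + (q v)%:E)%E) ->
  g z \is a fin_num.
Proof.
move=> [gN [v [Yv gv]]] Yz zmin; rewrite fin_numE gN//=.
apply/eqP => gz; have := zmin _ Yv; have := gN _ Yv.
by rewrite /aug_lag gz; case: (g v) gv.
Qed.

(** In the comparison with [z + t (u - z)], [g] is bounded by its chord and the other terms are
    quadratic in [t], so the coefficient of [t] is nonnegative. *)
Lemma aug_lag_argmin_optimality (R : realType) n n1 n2 N (Y : set 'cV[R]_n2)
    (f : 'I_N -> 'cV[R]_n1 -> R) g (A : 'M[R]_(n, n1)) (B : 'M[R]_(n, n2)) b beta
    (L : 'M[R]_n2) x lam yk z u :
  convex_set Y -> proper_on Y g -> econvex_on Y g -> L^T = L -> Y z -> Y u ->
  (forall v, Y v ->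
    (aug_lag f g A B b beta x z lam + (1 / 2 * sqnormG L (z - yk))%:E
     <= aug_lag f g A B b beta x v lam + (1 / 2 * sqnormG L (v - yk))%:E)%E) ->
  g z \is a fin_num -> g u \is a fin_num ->
  0 <= fine (g u) - fine (g z)
       + dotv (beta *: (A *m x + B *m z - b) - lam) (B *m (u - z))
       + dotv (L *m (z - yk)) (u - z).
Proof.
move=> cY [gN _] cg Ls Yz Yu zmin gzf guf.
set r := A *m x + B *m z - b.
apply: (@ge0_of_quadratic _ _
  (beta / 2 * sqnorm (B *m (u - z)) + 1 / 2 * sqnormG L (u - z))) => t t01.
have t01' : 0 <= t <= 1 by case/andP: t01 => *; rewrite !ltW.
have Yv := convex_set_line cY Yu Yz t01'.
have := cg _ _ _ Yu Yz t01; have := zmin _ Yv; have := gN _ Yv.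
have -> : t *: u + (1 - t) *: z = z + t *: (u - z).
  by rewrite scalerBl scale1r scalerBr addrCA.
rewrite -(fineK gzf) -(fineK guf) /aug_lag -(fineK gzf) -/r.
move: (fine (g u)) (fine (g z)) (favg f x) => gu gz F.
(* [-oo] is excluded by properness, [+oo] by the convexity bound, whose right side is finite. *)
case: (g _) => [gv||]//= _; rewrite -?EFinM -?EFinD ?lee_fin//.
have -> : A *m x + B *m (z + t *: (u - z)) - b = r + t *: (B *m (u - z)).
  by rewrite mulmxDr -scalemxAr addrA [LHS]addrAC.
rewrite ![z + t *: _ - _]addrAC sqnormG_line// sqnorm_line.
rewrite !(dotvDr, dotvDl, dotvNl, dotvZl, dotvZr); lra.
Qed.

(** * The bilinear identity and the final combination *)

(** In the notation of the proof, the last block row of [Qmat] yields [r - B ey], the residual at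
    [(x', y')], so [l0] cancels and [- <ltil, A dx + B dy>] remains; the other blocks account for
    the rest. *)
Lemma variational_assembly (R : realType) n n1 n2 (A : 'M[R]_(n, n1))
    (B : 'M[R]_(n, n2)) (M : 'M[R]_n1) (L : 'M[R]_n2) (b lk l0 : 'cV[R]_n)
    (xk x' x0 : 'cV[R]_n1) (yk y' y0 : 'cV[R]_n2) (beta tau : R) :
  0 < beta ->
  let ltil := lk - beta *: (A *m x' + B *m yk - b) in
  let dw := wvec x0 y0 l0 - wvec x' y' ltil in
  dotv dw (Jmap A B b x0 y0 l0)
  - bilin dw (Qmat (M - beta *: (A^T *m A)) L B beta tau)
      (wvec xk yk lk - wvec x' y' ltil)
  = dotv (hvec A B b beta xk yk lk) (x0 - x') + dotv (M *m (x' - xk)) (x0 - x')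
    + dotv (beta *: (A *m x' + B *m y' - b)
            - (lk - (tau * beta) *: (A *m x' + B *m yk - b))) (B *m (y0 - y'))
    + dotv (L *m (y' - yk)) (y0 - y').
Proof.
move=> beta0 ltil dw.
(* All residuals are [r] plus images of displacements, and [lk - ltil = beta *: r]. *)
pose r := A *m x' + B *m yk - b.
pose dx := x0 - x'; pose dy := y0 - y'; pose ex := xk - x'; pose ey := yk - y'.
have Ek : A *m xk + B *m yk - b = r + A *m ex.
  by rewrite /r /ex mulmxBr; apply/matrixP => i j; rewrite !mxE; ring.
have E' : A *m x' + B *m y' - b = r - B *m ey.
  by rewrite /r /ey mulmxBr; apply/matrixP => i j; rewrite !mxE; ring.
have E0 : A *m x0 + B *m y0 - b = r + A *m dx + B *m dy - B *m ey.
  by rewrite /r /dx /dy /ey !mulmxBr; apply/matrixP => i j; rewrite !mxE; ring.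
have elt : lk - ltil = beta *: r by rewrite /ltil -/r opprB addrC subrK.
rewrite /dw /hvec /wvec /Jmap /Qmat !opp_col_mx !add_col_mx bilinE.
rewrite Ek E' E0 -/r elt -[x' - xk]opprB -[y' - yk]opprB -/dx -/dy -/ex -/ey.
(* With the definitions forgotten, the identity is polynomial in pairings of independent vectors. *)
rewrite /ltil -/r; clearbody dx dy ex ey r.
rewrite mul_block_col mul_block_col mul_col_mx mul_row_col !mul0mx !add0r !addr0.
rewrite add_col_mx addr0 !dotv_col_mx mul_scalar_mx scalerA mulVf ?gt_eqF// scale1r.
rewrite !(mulmxN, mulmxBl, mulmxDl, mulNmx) -!scalemxAl -!mulmxA.
rewrite !(dotvDl, dotvDr, dotvNl, dotvNr, dotvZl, dotvZr) !dotv_trmxl.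
(* Every [A^T] and [B^T] is moved across its pairing, so that equal terms become syntactically
   equal. *)
rewrite !(dotvC dx (A^T *m _)) !(dotvC dy (B^T *m _)) !dotv_trmxl.
rewrite !(dotvDl, dotvDr, dotvNl, dotvNr, dotvZl, dotvZr).
rewrite (dotvC (M *m ex)) (dotvC (L *m ey)).
ring.
Qed.

(** Adding back [beta A^T A] can only increase the form, as [<v, A^T A v>] is a sum of squares. This
    makes the quadratic part of [Phi] convex. *)
Lemma sym_psd_shift (R : realType) n p (M : 'M[R]_p) (A : 'M[R]_(n, p)) beta :
  0 <= beta -> M^T = M -> sym_psd (M - beta *: (A^T *m A)) -> sym_psd M.
Proof.
move=> beta0 Ms [_ Dp]; split=> // v; apply: le_trans (Dp v) _.
rewrite !sqnormGE mulmxBl -scalemxAl -mulmxA dotvDr dotvNr dotvZr gerDl oppr_le0.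
by rewrite mulr_ge0// dotvC dotv_trmxl /dotv mxE sumr_ge0// => i _; rewrite mxE sqr_ge0.
Qed.

Theorem theorem2p2 (R : realType) (n1 n2 n N : nat)
  (X : set 'cV[R]_n1) (Y : set 'cV[R]_n2)
  (A : 'M[R]_(n, n1)) (B : 'M[R]_(n, n2)) (b : 'cV[R]_n)
  (g : 'cV[R]_n2 -> \bar R)
  (f : 'I_N -> 'cV[R]_n1 -> R) (Gr : 'I_N -> 'cV[R]_n1 -> 'cV[R]_n1)
  (U : set 'cV[R]_n1)
  (H : 'M[R]_n1) (nu : R) (beta : R) (L : 'M[R]_n2) (tau s : R)
  (x : nat -> 'cV[R]_n1) (y : nat -> 'cV[R]_n2) (lam : nat -> 'cV[R]_n)
  (xb : nat -> 'cV[R]_n1)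
  (m : nat -> nat) (eta : nat -> R) (M : nat -> 'M[R]_n1)
  (xi : nat -> nat -> 'I_N) (e : nat -> nat -> 'cV[R]_n1)
  (xs xbs : nat -> nat -> 'cV[R]_n1) (k : nat) :
  (* problem data *)
  X !=set0 -> closed X -> convex_set X ->
  Y !=set0 -> closed Y -> convex_set Y ->
  proper_on Y g -> econvex_on Y g ->
  (0 < N)%N ->
  open U -> X `<=` U ->
  (forall j, convex_on X (f j)) ->
  (forall j, C1_grad_on U (f j) (Gr j)) ->
  sym_pd H -> 0 < nu ->
  (forall j x1 x2, X x1 -> X x2 ->
     Num.sqrt (sqnormG (invmx H) (Gr j x1 - Gr j x2))
       <= nu * Num.sqrt (sqnormG H (x1 - x2))) ->
  (* algorithm parameters and run *)
  0 < beta -> sym_psd L -> in_Delta tau s ->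
  sas_admm_run X Y A B b f Gr g H L beta tau s x y lam xb m eta M xi e xs xbs ->
  (* the fixed outer index k *)
  0 < eta k < nu^-1 ->
  forall (x0 : 'cV[R]_n1) (y0 : 'cV[R]_n2) (l0 : 'cV[R]_n), X x0 -> Y y0 ->
    let ltil := lam k - beta *: (A *m x k.+1 + B *m y k - b) in
    let w := wvec x0 y0 l0 in
    let wt := wvec (x k.+1) (y k.+1) ltil in
    let wk := wvec (x k) (y k) (lam k) in
    let Qk := Qmat (M k - beta *: (A^T *m A)) L B beta tau in
    ((favg f x0)%:E + g y0 - ((favg f (x k.+1))%:E + g (y k.+1))
       + (dotv (w - wt)%R (Jmap A B b x0 y0 l0))%:E
     >= (bilin (w - wt) Qk (wk - wt)
          + zeta H nu Gr (xi k) (e k) (xs k) (xbs k) (m k) (eta k)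
                 (xb k) (xb k.+1) x0)%R%:E)%E.
Proof.
move=> _ _ cX Y0 _ cY pg cg N0 _ XU cf C1 Hp nu0 lip beta0 Lp _ run /andP[eta0 etanu]
  x0 y0 l0 Xx0 Yy0; cbv zeta.
have [Xk Xbk] := sas_admm_run_mem k cX run.
have [_ _ _ /(_ k) [m0 [_ [Ms [Dp [tr [xE [xbE [Yy' [ymin _]]]]]]]]]] := run.
have Mp := sym_psd_shift (ltW beta0) Ms Dp.
have en : eta k * nu < 1 by rewrite -ltr_pdivlMr// mul1r.
have dE j z (Xz : X z) h : 'd (f j) z h = dotv (Gr j z) h.
  by have [_ ->] := C1 j z (XU _ Xz).
have df j z (Xz : X z) : differentiable (f j) z by have [] := C1 j z (XU _ Xz).
have tang v v' : X v -> X v' -> favg f v + dotv (gavg Gr v) (v' - v) <= favg f v'.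
  move=> Xv Xv'; apply: favg_above_tangent => j.
  by rewrite -dE//; apply: convex_above_tangent (cf j) Xv Xv' (df j _ Xv).
have desc v v' : X v -> X v' ->
    favg f v' <= favg f v + dotv (gavg Gr v) (v' - v) + nu / 2 * sqnormG H (v' - v).
  move=> Xv Xv'; apply: favg_descent => // j.
  exact: descent_lemma cX Hp nu0 (df j) (dE j) (lip j) Xv Xv'.
have := xsub_gap_le_zeta m0 eta0 nu0 en cX Hp Mp tang desc Xk Xbk Xx0 tr.
rewrite -xE -xbE /xsub_gap => xineq.
have gy' := aug_lag_argmin_fin pg Yy' ymin.
(* If [g y0] is infinite, it is [+oo] by properness, and so is the larger side of the claim. *)
have [gy0|gy0] := boolP (g y0 \is a fin_num); last first.
  have -> : g y0 = +oo%E.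
    by move: gy0; rewrite fin_numE pg.1//= negbK => /eqP.
  by rewrite -(fineK gy') /= leey.
have yineq := aug_lag_argmin_optimality cY pg cg Lp.1 Yy' Yy0 ymin gy' gy0.
have asm := variational_assembly A B (M k) L b (lam k) l0 (x k) (x k.+1) x0
  (y k) (y k.+1) y0 tau beta0.
cbv zeta in asm.
(* All values of [g] are now finite, so the claim is real: [xineq], [yineq] and the identity [asm]
   add up to it. *)
rewrite -(fineK gy') -(fineK gy0) -?EFinD -?EFinN -?EFinD lee_fin.
rewrite -[x k.+1 - x0]opprB !dotvNr in xineq.
lra.
Qed.
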